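(* Let $N\ge1$ and let $A\in\mathbb{R}^{N\times N}$ be an Erdős matrix. Then all entries of $A$ are rational.
   Context: The maximal trace of an $N\times N$ matrix $A=(a_{ij})$ is $\operatorname{max\,tr}A=\max_\sigma\sum_{i=1}^N a_{i,\sigma(i)}$, where $\sigma$ ranges over all permutations of $\{1,\dots,N\}$, and $\|A\|^2=\sum_{i,j}a_{ij}^2$ is the squared Frobenius norm. $A\in\mathbb{R}^{N\times N}$ is called an Erdős matrix if it is doubly stochastic (nonnegative entries, all row and column sums equal to $1$) and $\|A\|^2=\operatorname{max\,tr}A$. *)

(* Defs.v *)
From HB Require Import structures.
From mathcomp Require Import all_boot all_order all_fingroup all_algebra.
From mathcomp Require Import reals.

Set Implicit Arguments.
Unset Strict Implicit.
Unset Printing Implicit Defensive.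

Import Order.TTheory GRing.Theory Num.Theory.

Local Open Scope ring_scope.

(* The default value of the iterated maximum is the term of the identity
   permutation, so this is a genuine maximum over the nonempty set 'S_N, with no
   spurious comparison to 0. *)
Definition maxtr (R : realDomainType) (N : nat) (A : 'M[R]_N) : R :=
  \big[Num.max / (\sum_(i < N) A i ((1%g : 'S_N) i))]_(s : 'S_N)
    \sum_(i < N) A i (s i).

Definition frobenius_sq (R : realDomainType) (N : nat) (A : 'M[R]_N) : R :=
  \sum_(i < N) \sum_(j < N) A i j ^+ 2.

Definition doubly_stochastic (R : realDomainType) (N : nat) (A : 'M[R]_N) :=
  [/\ forall i j : 'I_N, 0 <= A i j,
      forall i : 'I_N, \sum_(j < N) A i j = 1
    & forall j : 'I_N, \sum_(i < N) A i j = 1].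

Definition Erdos_matrix (R : realDomainType) (N : nat) (A : 'M[R]_N) :=
  doubly_stochastic A /\ frobenius_sq A = maxtr A.

(* Main.v *)
Require Import Defs.
From HB Require Import structures.
From mathcomp Require Import all_boot all_order all_fingroup all_algebra.
From mathcomp Require Import reals.

Set Implicit Arguments.
Unset Strict Implicit.
Unset Printing Implicit Defensive.

Import Order.TTheory GRing.Theory Num.Theory.

Local Open Scope ring_scope.

(* By Birkhoff's theorem [A] is a convex combination of permutation matrices
   [P_k].  As [<A, A>] is the corresponding average of the numbers
   [<A, P_k> <= maxtr A], the Erdos condition forces [<A, P_k> = m := maxtr A]
   for every [k].  Thus [A / m] lies in the span of the [P_k] and has inner
   product 1 with each of them; these conditions have at most one solution, and
   they form a linear system with rational coefficients, so [A / m] is rational.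
   The row sums of [A] being 1, [m] is rational as well. *)

(** Halmos-Vaughan induction on [#|D|]. If some proper nonempty subset of [D] has exactly as many
    neighbours as elements, it and its complement are matched separately; otherwise any one pair can
    be matched and removed. Values in [option U] allow a total [f] even when [U] is empty. *)
Lemma hall_marriage (T U : finType) (D : {set T}) (F : T -> {set U}) :
  (forall S : {set T}, S \subset D -> (#|S| <= #|\bigcup_(x in S) F x|)%N) ->
  exists f : T -> option U, {in D &, injective f} /\
    {in D, forall x, exists2 y, f x = Some y & y \in F x}.
Proof.
elim: {D}_.+1 {-2}D (ltnSn #|D|) F => // n IHn D leDn F hallF.
have [->|[x0 x0D]] := set_0Vmem D.
  by exists (fun=> None); split=> [x|x]; rewrite inE.
pose tight (S : {set T}) :=
  [&& S \proper D, S != set0 & #|S| == #|\bigcup_(x in S) F x|].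
have [/existsP[S /and3P[SD S_n0 /eqP cardS]]|] := boolP [exists S, tight S].
  have SsD := proper_sub SD.
  have [|S' S'S|f [f_inj fF]] := IHn S _ F.
  - by rewrite -ltnS (leq_trans _ leDn) // ltnS proper_card.
  - by apply: hallF; apply: subset_trans SsD.
  set W := \bigcup_(x in S) F x in cardS.
  (* Hall's condition survives the removal of [W]: apply it to [S :|: S'] and cancel
     [#|S| = #|W|]. *)
  have [|S' S'D|g [g_inj gF]] := IHn (D :\: S) _ (fun x => F x :\: W).
  - rewrite -ltnS (leq_trans _ leDn) // ltnS proper_card //.
    rewrite properEneq subsetDl andbT; apply: contraNneq S_n0 => eqD.
    by rewrite -subset0; apply/subsetP => x xS; have := subsetP SsD x xS;
      rewrite -eqD inE xS.
  - have disSS' : S :&: S' = set0.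
      apply/setP => x; rewrite !inE; apply/negP => /andP[xS /(subsetP S'D)].
      by rewrite inE xS.
    have sub : \bigcup_(x in S :|: S') F x \subset
               W :|: \bigcup_(x in S') (F x :\: W).
      apply/bigcupsP => x; rewrite inE => /orP[xS|xS'].
        by apply: subset_trans (subsetUl _ _); apply: bigcup_sup xS.
      apply/subsetP => y yF; rewrite inE; case: (boolP (y \in W)) => //= yW.
      by apply/bigcupP; exists x => //; rewrite inE yW.
    have SS'D : S :|: S' \subset D.
      by rewrite subUset SsD (subset_trans S'D) ?subsetDl.
    have := leq_trans (hallF _ SS'D) (subset_leq_card sub).
    rewrite cardsU disSS' cards0 subn0 cardS => h.
    by have := leq_trans h (leq_card_setU _ _); rewrite leq_add2l.
  have cross x y : x \in S -> y \in D :\: S -> f x != g y.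
    move=> xS yS; have [a -> aF] := fF _ xS; have [b -> bF] := gF _ yS.
    apply/eqP => -[eab]; move: bF; rewrite inE -eab => /andP[/negP[]].
    by apply/bigcupP; exists x.
  exists (fun x => if x \in S then f x else g x); split=> [x y xD yD|x xD].
    case: ifPn => xS; case: ifPn => yS.
    - exact: f_inj.
    - by move/eqP; rewrite (negPf (cross _ _ xS _)) // inE yS.
    - by move/esym/eqP; rewrite (negPf (cross _ _ yS _)) // inE xS.
    - by apply: g_inj; rewrite inE ?xS ?yS.
  case: ifPn => xS; first exact: fF.
  by have [|y -> yF] := gF x; [rewrite inE xS | exists y => //; move: yF; rewrite inE => /andP[]].
rewrite negb_exists => /forallP not_tight.
have /card_gt0P[y0 y0F] : (0 < #|F x0|)%N.
  by have := hallF [set x0]; rewrite sub1set cards1 big_set1; apply.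
(* Without tight sets, a nonempty [S] avoiding [x0] has strictly more neighbours than elements, so
   losing [y0] is harmless. *)
have [|S SD|g [g_inj gF]] := IHn (D :\ x0) _ (fun x => F x :\ y0).
- by move: leDn; rewrite (cardsD1 x0) x0D.
- have [->|S_n0] := eqVneq S set0; first by rewrite cards0.
  have SpD : S \proper D by apply: sub_proper_trans SD (properD1 x0D).
  have := not_tight S; rewrite /tight SpD S_n0 /= => /negPf neq.
  have := hallF S (proper_sub SpD); rewrite leq_eqVlt neq /= => /leq_trans h.
  have sub : \bigcup_(x in S) F x \subset y0 |: \bigcup_(x in S) (F x :\ y0).
    apply/bigcupsP => x xS; apply/subsetP => y yF; rewrite !inE.
    have [//|yy0 /=] := eqVneq y y0.
    by apply/bigcupP; exists x => //; rewrite !inE yy0.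
  have := h _ (subset_leq_card sub); rewrite cardsU1 => /leq_trans h'.
  have := h' (1 + #|\bigcup_(x in S) (F x :\ y0)|)%N.
  by rewrite leq_add2r leq_b1 add1n ltnS; apply.
have avoid x : x \in D :\ x0 -> g x != Some y0.
  by move=> /gF[y -> yF]; apply: contraTneq yF => -[->]; rewrite !inE eqxx.
exists (fun x => if x == x0 then Some y0 else g x); split=> [x y xD yD|x xD].
  have [->|nx] := eqVneq x x0; have [->|ny] := eqVneq y x0 => //.
  - by move/esym/eqP; rewrite (negPf (avoid _ _)) // !inE ny.
  - by move/eqP; rewrite (negPf (avoid _ _)) // !inE nx.
  - by apply: g_inj; rewrite !inE ?nx ?ny.
have [->|nx] := eqVneq x x0; first by exists y0.
have [|y -> yF] := gF x; first by rewrite !inE nx.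
by exists y => //; move: yF; rewrite inE => /andP[].
Qed.

(** Hall's theorem applies to the support: the rows in [S] carry mass [c *+ #|S|], all of it inside
    the columns of [W], which carry only [c *+ #|W|]. *)
Lemma perm_of_support (R : realDomainType) (N : nat) (A : 'M[R]_N) (c : R) :
  0 < c -> (forall i j, 0 <= A i j) ->
  (forall i, \sum_j A i j = c) -> (forall j, \sum_i A i j = c) ->
  exists s : 'S_N, forall i, 0 < A i (s i).
Proof.
move=> c_gt0 A_ge0 rowA colA.
have [S _|f [f_inj fF]] :=
    @hall_marriage _ _ [set: 'I_N] (fun i => [set j | A i j != 0]).
  set W := \bigcup_(x in S) _.
  have rowS : \sum_(i in S) \sum_(j in W) A i j = c *+ #|S|.
    rewrite -sumr_const; apply: eq_bigr => i iS.
    rewrite -(rowA i) [RHS](bigID (mem W)) /= [X in _ + X]big1 ?addr0 // => j jW.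
    apply: contraNeq jW => Aij; apply/bigcupP; exists i => //.
    by rewrite inE.
  have colW : \sum_(j in W) \sum_(i in S) A i j <= c *+ #|W|.
    rewrite -sumr_const; apply: ler_sum => j _.
    rewrite -(colA j) [leRHS](bigID (mem S)) /= lerDl.
    by apply: sumr_ge0 => *; apply: A_ge0.
  by move: colW; rewrite exchange_big rowS ler_pMn2l.
have [g gE] : exists g : 'I_N -> 'I_N, forall i, f i = Some (g i) /\ A i (g i) != 0.
  (* The default [i] is never reached, as [f] is defined everywhere. *)
  exists (fun i => odflt i (f i)) => i.
  by have [|y fi] := fF i; rewrite ?inE // => yF; rewrite fi.
have g_inj : injective g.
  by move=> i j gij; apply: f_inj; rewrite ?inE // !(gE _).1 gij.
exists (perm g_inj) => i; rewrite permE lt_def A_ge0 andbT.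
exact: (gE i).2.
Qed.

Lemma sum_perm_mx_row (R : pzSemiRingType) (N : nat) (s : 'S_N) (i : 'I_N) :
  \sum_j (perm_mx s : 'M[R]_N) i j = 1.
Proof.
rewrite (bigD1 (s i)) //= big1 => [|j jsi]; rewrite !mxE ?eqxx ?addr0 //.
by rewrite eq_sym (negPf jsi).
Qed.

Lemma sum_perm_mx_col (R : pzSemiRingType) (N : nat) (s : 'S_N) (j : 'I_N) :
  \sum_i (perm_mx s : 'M[R]_N) i j = 1.
Proof.
rewrite -(sum_perm_mx_row R s^-1 j); apply: eq_bigr => i _.
by rewrite !mxE (canF_eq (permK s)) eq_sym.
Qed.

(** Induction on the size of the support, peeling off one permutation matrix at a time. The common
    line sum [c] is arbitrary because each peeling lowers it. *)
Lemma birkhoff (R : realDomainType) (N : nat) (A : 'M[R]_N) (c : R) :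
  (forall i j, 0 <= A i j) ->
  (forall i, \sum_j A i j = c) -> (forall j, \sum_i A i j = c) ->
  exists2 r : seq (R * 'S_N), all (fun p => 0 < p.1) r &
    A = \sum_(p <- r) p.1 *: perm_mx p.2.
Proof.
pose supp (B : 'M[R]_N) := [set p : 'I_N * 'I_N | B p.1 p.2 != 0].
elim: {A}_.+1 {-2}A (ltnSn #|supp A|) c => // n IHn A leAn c A_ge0 rowA colA.
have [A0|[[i0 j0]]] := set_0Vmem (supp A).
  exists [::] => //; rewrite big_nil; apply/matrixP => i j; rewrite mxE.
  by apply: contra_eq A0 => Aij; apply/set0Pn; exists (i, j); rewrite inE.
rewrite inE /= => A0.
have c_gt0 : 0 < c.
  rewrite -(rowA i0) (bigD1 j0) //= ltr_pwDl ?lt_def ?A0 ?A_ge0 //.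
  by apply: sumr_ge0 => *; apply: A_ge0.
have [s s_gt0] := perm_of_support c_gt0 A_ge0 rowA colA.
(* Subtracting the least entry [d] along [s] keeps all entries nonnegative and kills the entry at
   [(i1, s i1)], so the support shrinks. *)
case: (@Order.TotalTheory.arg_minP _ _ _ i0 xpredT (fun i => A i (s i))) => // i1 _ min_i1.
pose d := A i1 (s i1); pose B := A - d *: perm_mx s.
have BE i j : B i j = if s i == j then A i j - d else A i j.
  by rewrite !mxE; case: eqP; rewrite ?mulr1 // mulr0 subr0.
have [||||r r_gt0 Br] := IHn B _ (c - d).
- rewrite -ltnS (leq_trans _ leAn) // ltnS proper_card //; apply/properP; split.
    apply/subsetP => -[i j]; rewrite !inE /= BE; case: (s i =P j) => [<- _|//].
    by rewrite lt0r_neq0.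
  by exists (i1, s i1); rewrite !inE /= ?BE ?eqxx ?subrr ?eqxx ?lt0r_neq0.
- by move=> i j; rewrite BE; case: (s i =P j) => // <-; rewrite subr_ge0 min_i1.
- move=> i; under eq_bigr do rewrite mxE [X in _ + X]mxE [X in - X]mxE.
  by rewrite sumrB rowA -mulr_sumr sum_perm_mx_row mulr1.
- move=> j; under eq_bigr do rewrite mxE [X in _ + X]mxE [X in - X]mxE.
  by rewrite sumrB colA -mulr_sumr sum_perm_mx_col mulr1.
exists ((d, s) :: r); first by rewrite /= s_gt0.
by rewrite big_cons -Br /= addrC subrK.
Qed.

(** A rational linear system solvable over [R] is solvable over [rat], since row-space inclusion is
    insensitive to field extension. Two solutions have the same image under [V]: their difference
    [z] satisfies [z V V^T = 0], so [z V] has squared norm zero. *)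
Lemma rational_of_gram (R : realFieldType) (n d : nat)
  (V : 'M[rat]_(n, d)) (b : 'rV[rat]_n) (y : 'rV[R]_n) :
  y *m map_mx ratr V *m (map_mx ratr V)^T = map_mx ratr b ->
  exists a : 'rV[rat]_d, y *m map_mx ratr V = map_mx ratr a.
Proof.
set VR := map_mx ratr V => yb.
have /submxP[x bx] : (b <= V *m V^T)%MS.
  rewrite -(map_submx (@ratr R)) map_mxM -map_trmx -yb -mulmxA.
  exact: submxMl.
exists (x *m V); rewrite map_mxM; apply/eqP; rewrite -subr_eq0 -mulmxBl.
set z := y - _; have zV : z *m VR *m VR^T = 0.
  by rewrite !mulmxBl yb bx !map_mxM -map_trmx mulmxA subrr.
have : (z *m VR) *m (z *m VR)^T = 0 by rewrite trmx_mul mulmxA zV mul0mx.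
move/matrixP/(_ 0 0); rewrite !mxE => z0; apply/eqP/rowP => k; rewrite [RHS]mxE.
have z_ge0 i : true -> 0 <= (z *m VR) 0 i * (z *m VR)^T i 0.
  by rewrite [_^T i 0]mxE -expr2 sqr_ge0.
have /eqP : (z *m VR) 0 k * (z *m VR)^T k 0 = 0 := psumr_eq0P z_ge0 z0 isT.
by rewrite [_^T k 0]mxE mulf_eq0 orbb => /eqP.
Qed.

Lemma le_maxtr (R : realDomainType) (N : nat) (A : 'M[R]_N) (s : 'S_N) :
  \sum_i A i (s i) <= maxtr A.
Proof. exact: le_bigmax. Qed.

Lemma sum_mulr_perm_mx (R : pzRingType) (N : nat) (A : 'M[R]_N) (s : 'S_N) :
  \sum_i \sum_j A i j * perm_mx s i j = \sum_i A i (s i).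
Proof.
apply: eq_bigr => i _; rewrite (bigD1 (s i)) //= big1 => [|j jsi].
  by rewrite !mxE eqxx mulr1 addr0.
by rewrite !mxE eq_sym (negPf jsi) mulr0.
Qed.

Lemma mxvec_mul_tr (R : pzRingType) (m n : nat) (A B : 'M[R]_(m, n)) :
  \sum_k mxvec A 0 k * mxvec B 0 k = \sum_i \sum_j A i j * B i j.
Proof.
rewrite pair_bigA (reindex _ (curry_mxvec_bij m n)) /=.
by apply: eq_bigr => -[i j] _; rewrite /= !mxvecE.
Qed.

Lemma Erdos_convex_decomposition (R : realDomainType) (N : nat) (A : 'M[R]_N) :
  (0 < N)%N -> Erdos_matrix A ->
  exists n (s : 'I_n -> 'S_N) (w : 'I_n -> R),
    A = \sum_k w k *: perm_mx (s k) /\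
    forall k, \sum_i A i (s k i) = maxtr A.
Proof.
case: N A => // N A _ [[A_ge0 rowA colA] frobA].
have [r r_gt0 Ar] := birkhoff A_ge0 rowA colA.
pose p k := tnth (in_tuple r) k.
have {}Ar : A = \sum_k (p k).1 *: perm_mx (p k).2 by rewrite {1}Ar big_tnth.
have w_gt0 k : 0 < (p k).1 by apply: (allP r_gt0); apply: mem_tnth.
exists (size r), (fun k => (p k).2), (fun k => (p k).1); split=> //.
(* Row 0 of [A] reads off the total weight, each permutation matrix having row sum 1. *)
have sum_w : \sum_k (p k).1 = 1.
  rewrite -(rowA 0) Ar; under [RHS]eq_bigr do rewrite summxE.
  rewrite exchange_big; apply: eq_bigr => k _ /=.
  under eq_bigr do rewrite mxE.
  by rewrite -mulr_sumr sum_perm_mx_row mulr1.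
(* Expand only one of the two factors [A] in the squared norm. *)
have avg : \sum_k (p k).1 * (\sum_i A i ((p k).2 i)) = maxtr A.
  rewrite -frobA /frobenius_sq.
  under [RHS]eq_bigr do under eq_bigr do rewrite expr2 {2}Ar summxE mulr_sumr.
  under [RHS]eq_bigr do rewrite exchange_big.
  rewrite exchange_big; apply: eq_bigr => k _ /=.
  rewrite -sum_mulr_perm_mx mulr_sumr; apply: eq_bigr => i _.
  by rewrite mulr_sumr; apply: eq_bigr => j _; rewrite [in RHS]mxE mulrCA.
(* The weighted gaps to the maximum are nonnegative and sum to zero, so each vanishes; positive
   weights then cancel. *)
have gap_ge0 k : true -> 0 <= (p k).1 * (maxtr A - \sum_i A i ((p k).2 i)).
  by move=> _; rewrite mulr_ge0 ?(ltW (w_gt0 k)) // subr_ge0 le_maxtr.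
have gap0 : \sum_k (p k).1 * (maxtr A - \sum_i A i ((p k).2 i)) = 0.
  under eq_bigr do rewrite mulrBr.
  by rewrite sumrB avg -mulr_suml sum_w mul1r subrr.
move=> k; apply/esym/eqP.
have /eqP : (p k).1 * (maxtr A - \sum_i A i ((p k).2 i)) = 0.
  exact: (psumr_eq0P gap_ge0 gap0).
by rewrite mulf_eq0 (gt_eqF (w_gt0 k)) subr_eq0.
Qed.

Theorem corollary5p6 (R : realType) (N : nat) (hN : (1 <= N)%N)
  (A : 'M[R]_N) (hA : Erdos_matrix A) :
  forall i j : 'I_N, exists q : rat, A i j = ratr q.
Proof.
have [n [s [w [Aw trA]]]] := Erdos_convex_decomposition hN hA.
case: hA => -[A_ge0 rowA _] frobA; set m := maxtr A in trA frobA.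
(* If [m], the squared norm, were zero, row [i0] would vanish, against its sum being 1. *)
have m_neq0 : m != 0.
  apply/eqP => m0; rewrite -frobA in m0.
  have row_ge0 i : true -> 0 <= \sum_j A i j ^+ 2.
    by move=> _; apply: sumr_ge0 => j _; apply: sqr_ge0.
  pose i0 := Ordinal hN.
  have row0 : \sum_j A i0 j ^+ 2 = 0 := psumr_eq0P row_ge0 m0 isT.
  have /eqP := rowA i0; rewrite big1 ?(eq_sym 0) ?oner_eq0 // => j _.
  apply/eqP; rewrite -sqrf_eq0; apply/eqP.
  exact: (psumr_eq0P (fun j _ => sqr_ge0 (A i0 j)) row0).
(* The rows of [V] are the flattened permutation matrices, so multiplying by its transpose takes
   inner products with all of them. *)
pose V : 'M[rat]_(n, N * N) := \matrix_k mxvec (perm_mx (s k)).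
have VE k : row k (map_mx ratr V) = mxvec (perm_mx (s k)) :> 'rV[R]_(N * N).
  by rewrite -map_row rowK map_mxvec map_perm_mx.
pose y := \row_k (m^-1 * w k).
have yV : y *m map_mx ratr V = mxvec (m^-1 *: A).
  rewrite mulmx_sum_row Aw scaler_sumr linear_sum; apply: eq_bigr => k _.
  by rewrite VE mxE scalerA linearZ.
(* Dividing by [m] makes every inner product equal to 1, hence the rational right-hand side
   [const_mx 1]. *)
have [|a aE] := @rational_of_gram R n _ V (const_mx 1) y.
  rewrite yV; apply/rowP => k; rewrite !mxE rmorph1 linearZ /=.
  under eq_bigr => l _.
    have -> : (map_mx ratr V)^T l k = mxvec (perm_mx (s k)) 0 l :> R.
      by rewrite -VE !mxE.
    rewrite mxE -mulrA; over.
  by rewrite -mulr_sumr mxvec_mul_tr sum_mulr_perm_mx trA mulVf.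
have AE i j : A i j = m * ratr (vec_mx a i j).
  have := mxvecE (m^-1 *: A) i j; rewrite -yV aE !mxE => ->.
  by rewrite mulVKf.
(* Row [i] of [A / m] sums to [m^-1], so dividing its entries by that sum recovers those of [A]. *)
move=> i j; exists (vec_mx a i j / \sum_k vec_mx a i k).
have rowi : m * ratr (\sum_k vec_mx a i k) = 1.
  by rewrite -[RHS](rowA i) raddf_sum mulr_sumr; apply: eq_bigr => k _ /=; rewrite AE.
have sum_neq0 : ratr (\sum_k vec_mx a i k) != 0 :> R.
  by apply: contra_eq_neq rowi => ->; rewrite mulr0 eq_sym oner_eq0.
by rewrite fmorph_div AE; apply: (canRL (mulfK _)) => //; rewrite mulrAC rowi mul1r.
Qed.
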